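(* Let $V=\{1,\dots,n\}$ with $n\ge1$ and let $w\in\mathbb{R}^n$ have all $w_i>0$. (a) Suppose $f:2^V\to\mathbb{R}_+$ is a non-decreasing submodular function with $f(\emptyset)=0$ and $P_{f,w}$ is decreasing. Then there is an optimal Player 1 strategy $x$ for $\Gamma_{\max}(\mathcal{B}(f),w)$ (given as a probability distribution on pure strategies) such that a random pure strategy $x^\sigma$ for Player 1, drawn from the distribution on pure strategies defined by $x$, can be generated in $O(n)$ time. (b) Suppose $g:2^V\to\mathbb{R}_+$ is a non-decreasing supermodular function with $g(\emptyset)=0$ and $P_{g,w}$ is increasing. Then there is an optimal Player 1 strategy $x$ for $\Gamma_{\min}(\mathcal{B}(g),w)$ (given as a probability distribution on pure strategies) such that a random pure strategy $x^\sigma$ for Player 1, drawn from the distribution on pure strategies defined by $x$, can be generated in $O(n)$ time.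
   Context: For $x\in\mathbb{R}^n$ and $S\subseteq V$, write $x(S)=\sum_{j\in S}x_j$. Base polyhedra: for submodular $f$, $\mathcal{B}(f)=\{x\in\mathbb{R}^n_+:x(S)\le f(S)\ \forall S\subseteq V,\ x(V)=f(V)\}$; for supermodular $g$, $\mathcal{B}(g)=\{x\in\mathbb{R}^n:x(S)\ge g(S)\ \forall S\subseteq V,\ x(V)=g(V)\}$. For $\phi\in\{f,g\}$, the vertices of $\mathcal{B}(\phi)$ are the points $x^\sigma$, $\sigma$ a permutation of $V$, with $x^\sigma_{\sigma(j)}=\phi(\{\sigma(1),\dots,\sigma(j)\})-\phi(\{\sigma(1),\dots,\sigma(j-1)\})$. Games: in $\Gamma_{\max}(\mathcal{B}(\phi),w)$ and $\Gamma_{\min}(\mathcal{B}(\phi),w)$ a pure strategy of Player 1 is a permutation $\sigma$ of $V$ (equivalently a vertex $x^\sigma$ of $\mathcal{B}(\phi)$), a pure strategy of Player 2 is $j\in V$, and the payoff is $P_{\phi,w}(\sigma,j)=w_jx^\sigma_j$. In $\Gamma_{\max}$ Player 1 maximizes and Player 2 minimizes; in $\Gamma_{\min}$ Player 1 minimizes and Player 2 maximizes. A mixed strategy of Player 1 is a probability distribution $(\theta_\sigma)$ on permutations, with corresponding point $x=\sum_\sigma\theta_\sigma x^\sigma\in\mathcal{B}(\phi)$ and expected payoff $w_jx_j$ against $j$. It is optimal in $\Gamma_{\max}(\mathcal{B}(f),w)$ if it attains $\max_{x\in\mathcal{B}(f)}\min_jw_jx_j$, and optimal in $\Gamma_{\min}(\mathcal{B}(g),w)$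 if it attains $\min_{x\in\mathcal{B}(g)}\max_jw_jx_j$. The payoff $P_{\phi,w}$ is decreasing (respectively increasing) if for every permutation $\sigma$ of $V$ and all $i,j\in V$ with $\sigma^{-1}(i)<\sigma^{-1}(j)$, $P_{\phi,w}(\sigma,i)\ge P_{\phi,w}(\sigma,j)$ (respectively $\le$). Computational model: $f$ (respectively $g$) is given by an oracle returning the value at a queried set, and each oracle query takes constant time. Arithmetic operations on reals and a random choice between two alternatives with a computed probability also take constant time. Generating the random pure strategy means outputting a random permutation $\sigma$ with probability $\theta_\sigma$. The $O(n)$ bound has a universal constant, independent of $f$, $g$ and $w$. *)

(* Defs.v *)
From mathcomp Require Import all_boot all_order all_fingroup all_algebra.
From mathcomp Require Import reals.

Set Implicit Arguments.
Unset Strict Implicit.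
Unset Printing Implicit Defensive.
Import Order.TTheory GRing.Theory Num.Theory.
Local Open Scope ring_scope.

(* The ground set V = {1, ..., n} is 'I_n, numbered from 0. *)

Definition nondecreasing_fun (R : realType) (n : nat) (phi : {set 'I_n} -> R) :=
  forall S T : {set 'I_n}, S \subset T -> phi S <= phi T.

Definition submodular (R : realType) (n : nat) (f : {set 'I_n} -> R) :=
  forall S T : {set 'I_n}, f (S :|: T) + f (S :&: T) <= f S + f T.

Definition supermodular (R : realType) (n : nat) (g : {set 'I_n} -> R) :=
  forall S T : {set 'I_n}, g S + g T <= g (S :|: T) + g (S :&: T).

Definition in_base_sub (R : realType) (n : nat) (f : {set 'I_n} -> R)
    (x : 'rV[R]_n) :=
  [/\ forall j, 0 <= x 0 j,
      forall S : {set 'I_n}, \sum_(j in S) x 0 j <= f S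
    & \sum_j x 0 j = f [set: 'I_n]].

Definition in_base_super (R : realType) (n : nat) (g : {set 'I_n} -> R)
    (x : 'rV[R]_n) :=
  (forall S : {set 'I_n}, g S <= \sum_(j in S) x 0 j) /\
  \sum_j x 0 j = g [set: 'I_n].

(* [s i] is the element in position [i]; the entry of x^s at v is the increment
   of phi when v, which sits in position s^-1 v, is appended. *)
Definition vertex (R : realType) (n : nat) (phi : {set 'I_n} -> R)
    (s : 'S_n) : 'rV[R]_n :=
  \row_v (phi [set s i | i : 'I_n & (i <= (s^-1)%g v)%N]
          - phi [set s i | i : 'I_n & (i < (s^-1)%g v)%N]).

Definition payoff (R : realType) (n : nat) (phi : {set 'I_n} -> R)
    (w : 'rV[R]_n) (s : 'S_n) (j : 'I_n) : R :=
  w 0 j * vertex phi s 0 j.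

Definition payoff_decreasing (R : realType) (n : nat) (phi : {set 'I_n} -> R)
    (w : 'rV[R]_n) :=
  forall (s : 'S_n) (i j : 'I_n), ((s^-1)%g i < (s^-1)%g j)%N ->
    payoff phi w s j <= payoff phi w s i.

Definition payoff_increasing (R : realType) (n : nat) (phi : {set 'I_n} -> R)
    (w : 'rV[R]_n) :=
  forall (s : 'S_n) (i j : 'I_n), ((s^-1)%g i < (s^-1)%g j)%N ->
    payoff phi w s i <= payoff phi w s j.

Definition mixed_strategy (R : realType) (n : nat) (theta : {ffun 'S_n -> R}) :=
  (forall s, 0 <= theta s) /\ \sum_s theta s = 1.

Definition mixed_point (R : realType) (n : nat) (phi : {set 'I_n} -> R)
    (theta : {ffun 'S_n -> R}) : 'rV[R]_n :=
  \sum_s theta s *: vertex phi s.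

(* The ground set is nonempty, so that the seed [w_0 x_0] does not matter. *)
Definition min_payoff (R : realType) (n : nat) (w x : 'rV[R]_n.+1) : R :=
  \big[Num.min/w 0 ord0 * x 0 ord0]_(j < n.+1) (w 0 j * x 0 j).

Definition max_payoff (R : realType) (n : nat) (w x : 'rV[R]_n.+1) : R :=
  \big[Num.max/w 0 ord0 * x 0 ord0]_(j < n.+1) (w 0 j * x 0 j).

Definition optimal_max (R : realType) (n : nat) (f : {set 'I_n.+1} -> R)
    (w : 'rV[R]_n.+1) (theta : {ffun 'S_n.+1 -> R}) :=
  [/\ mixed_strategy theta, in_base_sub f (mixed_point f theta)
    & forall y, in_base_sub f y ->
        min_payoff w y <= min_payoff w (mixed_point f theta)].

Definition optimal_min (R : realType) (n : nat) (g : {set 'I_n.+1} -> R)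
    (w : 'rV[R]_n.+1) (theta : {ffun 'S_n.+1 -> R}) :=
  [/\ mixed_strategy theta, in_base_super g (mixed_point g theta)
    & forall y, in_base_super g y ->
        max_payoff w (mixed_point g theta) <= max_payoff w y].

(* The computational model is a unit-cost real RAM with a set-function oracle
   and biased coins.  A program is a finite syntactic object that mentions
   neither n, nor the oracle, nor w, so one program serves all inputs.  Its
   memory consists of
   - registers and an array holding natural numbers (indices),
   - registers and an array holding reals,
   - set registers, i.e. bit vectors, updated one element at a time.
   In the constructors below the nat arguments are register names, except the
   literal [k] of [IConst] and [RConst]. *)

Inductive op :=
  | IConst (a k : nat)
  | IAdd (a b c : nat)
  | ISub (a b c : nat)
  | ILoad (a b : nat)
  | IStore (a b : nat)
  | RConst (a k : nat)
  | RAdd (a b c : nat)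
  | RSub (a b c : nat)
  | RMul (a b c : nat)
  | RDiv (a b c : nat)
  | RLoad (a b : nat)
  | RStore (a b : nat)
  | SInsert (s b : nat)
  | SDelete (s b : nat)
  | Query (a s : nat).

Inductive test :=
  | IEq (a b : nat)
  | ILt (a b : nat)
  | REq (a b : nat)
  | RLt (a b : nat)
  | SIn (s b : nat).

Inductive instr :=
  | Do of op
  | If of test & seq instr & seq instr
  | While of test & seq instr
  | Flip of nat & seq instr & seq instr.

Definition program := seq instr.

Record state (R : realType) := State {
  ireg : nat -> nat;
  iarr : nat -> nat;
  rreg : nat -> R;
  rarr : nat -> R;
  sreg : nat -> nat -> bool }.

Definition upd (T : Type) (m : nat -> T) (a : nat) (v : T) : nat -> T :=
  fun b => if b == a then v else m b.

Definition exec (R : realType) (n : nat) (phi : {set 'I_n} -> R)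
    (o : op) (st : state R) : state R :=
  let: State ir ia rr ra sr := st in
  match o with
  | IConst a k => State (upd ir a k) ia rr ra sr
  | IAdd a b c => State (upd ir a (ir b + ir c)%N) ia rr ra sr
  | ISub a b c => State (upd ir a (ir b - ir c)%N) ia rr ra sr
  | ILoad a b => State (upd ir a (ia (ir b))) ia rr ra sr
  | IStore a b => State ir (upd ia (ir a) (ir b)) rr ra sr
  | RConst a k => State ir ia (upd rr a k%:R) ra sr
  | RAdd a b c => State ir ia (upd rr a (rr b + rr c)) ra sr
  | RSub a b c => State ir ia (upd rr a (rr b - rr c)) ra sr
  | RMul a b c => State ir ia (upd rr a (rr b * rr c)) ra sr
  | RDiv a b c => State ir ia (upd rr a (rr b / rr c)) ra sr
  | RLoad a b => State ir ia (upd rr a (ra (ir b))) ra sr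
  | RStore a b => State ir ia rr (upd ra (ir a) (rr b)) sr
  | SInsert s b => State ir ia rr ra (upd sr s (upd (sr s) (ir b) true))
  | SDelete s b => State ir ia rr ra (upd sr s (upd (sr s) (ir b) false))
  | Query a s => State ir ia (upd rr a (phi [set v : 'I_n | sr s v])) ra sr
  end.

Definition eval_test (R : realType) (t : test) (st : state R) : bool :=
  match t with
  | IEq a b => ireg st a == ireg st b
  | ILt a b => (ireg st a < ireg st b)%N
  | REq a b => rreg st a == rreg st b
  | RLt a b => rreg st a < rreg st b
  | SIn s b => sreg st s (ireg st b)
  end.

(* The input is n in index register 0 and w in the real array; all other cells
   are 0 and all set registers are empty. *)
Definition init_state (R : realType) (n : nat) (w : 'rV[R]_n) : state R :=
  State (upd (fun=> 0%N) 0 n) (fun=> 0%N) (fun=> 0)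
        (fun i => if insub i is Some j then w 0 (j : 'I_n) else 0)
        (fun _ _ => false).

(* The output is read off the first n cells of the index array. *)
Definition outputs (R : realType) (n : nat) (st : state R) (s : 'S_n) : bool :=
  [forall i : 'I_n, iarr st i == s i :> nat].

(* Probability that executing the instruction stack [K] from [st] halts within
   [t] steps with output [s].  Every elementary operation, test and coin flip
   is one step.  [Flip a K1 K2] runs [K1] with the probability p held in real
   register [a] and [K2] with probability 1 - p; it crashes, never producing
   an output, if p is not in [0, 1]. *)
Fixpoint output_prob (R : realType) (n : nat) (phi : {set 'I_n} -> R)
    (t : nat) (K : seq instr) (st : state R) (s : 'S_n) {struct t} : R :=
  match K, t with
  | [::], _ => (outputs st s)%:R
  | _ :: _, 0 => 0
  | Do o :: K', t'.+1 => output_prob phi t' K' (exec phi o st) s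
  | If b K1 K2 :: K', t'.+1 =>
      output_prob phi t' ((if eval_test b st then K1 else K2) ++ K') st s
  | While b K1 :: K', t'.+1 =>
      output_prob phi t' (if eval_test b st then K1 ++ K else K') st s
  | Flip a K1 K2 :: K', t'.+1 =>
      let p := rreg st a in
      if 0 <= p <= 1 then
        p * output_prob phi t' (K1 ++ K') st s
        + (1 - p) * output_prob phi t' (K2 ++ K') st s
      else 0
  end.

(* As the [theta s] of a mixed strategy add up to 1, this also says that almost
   every run halts within [t] steps with a permutation as output. *)
Definition generates_within (R : realType) (n : nat) (P : program) (t : nat)
    (phi : {set 'I_n} -> R) (w : 'rV[R]_n) (theta : {ffun 'S_n -> R}) :=
  forall s : 'S_n, output_prob phi t P (init_state w) s = theta s.

(* Main.v *)
Require Import Defs.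
From mathcomp Require Import all_boot all_order all_fingroup all_algebra.
From mathcomp Require Import reals.
From mathcomp Require Import ring lra zify.

(** Put [pi(S) = sum_(i in S) 1 / w_i].  The optimal point is the one that makes
    all payoffs equal, [x_j = phi(V) / (w_j pi(V))], for either game.

    Optimality.  If all payoffs [w_j y_j] are at least [m], then
    [m pi(V) <= y(V) = phi(V)], so no point of the base polyhedron guarantees
    more than [phi(V) / pi(V)], and dually for the minimizing player
    ([min_payoff_le], [max_payoff_ge]).  That the equalizing point lies in the
    base polyhedron is where monotonicity of the payoff enters: along an order
    that starts with [S], every payoff inside [S] is at least every payoff
    outside, and averaging these comparisons gives
    [phi(S) / pi(S) >= phi(V) / pi(V)].  The version with prefixes
    is [gain_ratio].

    Sampling.  The elements are placed one at a time, from the largest index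
    down, each at the first or at the last free position.  Say that [F] fills
    the front and that [0, ..., k] are still to be placed.  Whatever the coin,
    [F] and [F U {0, ..., k}] are prefixes of the final order, so the entries of
    the free elements add up to [total = phi(F U {0, ..., k}) - phi(F)].
    Element [k] gets [first] if it goes to the front and [last] if it goes to the
    back, and both numbers are known at once.  By [gain_ratio] the balanced share
    of [k], namely [total] times [(1 / w_k) / pi({0, ..., k})], lies between
    [last] and [first], so some bias [p] gives [k] this share on average
    ([coin_spec]).  In both branches the others then share what remains in
    proportion to [1 / w_j], by induction; since [k] took its share on average,
    so do they ([law_mean]).  Each step asks four oracle values, of sets that
    differ from the previous ones in one element, so a step takes constant time
    ([place_correct]).

    The increasing case follows from the decreasing one for [- phi]: entries
    change sign, while the coin, a quotient of two linear expressions in [phi],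
    does not. *)

Set Implicit Arguments.
Unset Strict Implicit.
Unset Printing Implicit Defensive.
Import Order.TTheory GRing.Theory Num.Theory.
Local Open Scope ring_scope.

(* [iota 0 k.+1] has to keep its shape, as [k] is removed from its end. *)
Local Arguments iota : simpl never.

(** * Orders as words *)

Section Words.
Variable n : nat.
Implicit Types (s : 'S_n.+1) (L P Q F M : seq nat).

(** Elements are represented by natural numbers, the format in which a program
    handles them. *)
Definition seq_set L : {set 'I_n.+1} := [set v : 'I_n.+1 | val v \in L].

Definition word s : seq nat := [seq val (s i) | i <- enum 'I_n.+1].

Lemma size_word s : size (word s) = n.+1.
Proof. by rewrite size_map size_enum_ord. Qed.

Lemma nth_word s (i : 'I_n.+1) : nth 0%N (word s) i = s i.
Proof. by rewrite (nth_map ord0) ?size_enum_ord // nth_ord_enum. Qed.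

Lemma word_uniq s : uniq (word s).
Proof. by rewrite map_inj_uniq ?enum_uniq // => i j /val_inj/perm_inj. Qed.

Lemma perm_word s : perm_eq (word s) (iota 0 n.+1).
Proof.
apply: uniq_perm (word_uniq s) (iota_uniq _ _) _ => v.
rewrite mem_iota add0n /=; apply/mapP/idP => [[i _ ->]|v_lt].
  exact: ltn_ord.
exists ((s^-1)%g (Ordinal v_lt)); first by rewrite mem_enum.
by rewrite permKV.
Qed.

Lemma index_word s (v : 'I_n.+1) : index (val v) (word s) = (s^-1)%g v.
Proof.
have -> : val v = nth 0%N (word s) ((s^-1)%g v) by rewrite nth_word permKV.
rewrite index_uniq ?word_uniq //.
by rewrite size_word.
Qed.

Lemma word_surj L : perm_eq L (iota 0 n.+1) -> exists s, word s = L.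
Proof.
move=> permL.
have szL : size L = n.+1 by rewrite (perm_size permL) size_iota.
have ltL i : (i < n.+1)%N -> (nth 0%N L i < n.+1)%N.
  move=> i_lt; have := mem_nth 0%N (s := L) (n := i).
  by rewrite szL (perm_mem permL) mem_iota add0n => /(_ i_lt).
pose h (i : 'I_n.+1) : 'I_n.+1 := inord (nth 0%N L i).
have hE i : val (h i) = nth 0%N L i by rewrite /h /= inordK // ltL.
have injh : injective h.
  move=> i j /(congr1 val); rewrite !hE => /eqP.
  rewrite nth_uniq ?szL // ?(perm_uniq permL) ?iota_uniq //.
  by move=> /eqP/val_inj.
exists (perm injh); apply: (@eq_from_nth _ 0%N); first by rewrite size_word.
move=> i; rewrite size_word => i_lt.
by rewrite -[i]/(val (Ordinal i_lt)) nth_word permE hE.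
Qed.

Lemma prefix_word s p :
  [set s i | i : 'I_n.+1 & (i < p)%N] = seq_set (take p (word s)).
Proof.
apply/setP => v; have vs: val v \in word s.
  by rewrite (perm_mem (perm_word s)) mem_iota /= ltn_ord.
rewrite inE in_take // index_word; apply/imsetP/idP => [[i]|v_lt].
  by rewrite inE => i_lt ->; rewrite permK.
by exists ((s^-1)%g v); rewrite ?inE ?permKV.
Qed.

Lemma eq_seq_set L1 L2 : L1 =i L2 -> seq_set L1 = seq_set L2.
Proof. by move=> eqL; apply/setP => v; rewrite !inE eqL. Qed.

Lemma iotaSr k : iota 0 k.+1 = rcons (iota 0 k) k.
Proof. by rewrite -addn1 iotaD cats1. Qed.

Lemma free_front k F B : perm_eq (F ++ iota 0 k.+1 ++ B) (iota 0 n.+1) ->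
  perm_eq (F ++ [:: k] ++ iota 0 k ++ B) (iota 0 n.+1).
Proof.
move=> permL; apply: perm_trans permL.
by rewrite perm_cat2l iotaSr catA perm_cat2r perm_sym perm_rcons.
Qed.

Lemma free_back k F B : perm_eq (F ++ iota 0 k.+1 ++ B) (iota 0 n.+1) ->
  perm_eq (F ++ iota 0 k ++ [:: k] ++ B) (iota 0 n.+1).
Proof. by rewrite iotaSr cat_rcons. Qed.

Lemma seq_set_front k F : seq_set (F ++ [:: k] ++ iota 0 k) = seq_set (F ++ iota 0 k.+1).
Proof.
by apply: eq_seq_set => v; rewrite iotaSr !mem_cat mem_rcons !inE.
Qed.

End Words.

(** * Consequences of a decreasing payoff *)

Section Decreasing.
Variables (R : realType) (n : nat) (w : 'rV[R]_n.+1).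
Implicit Types (phi : {set 'I_n.+1} -> R) (s : 'S_n.+1) (L P Q F M B : seq nat).
Hypothesis w_gt0 : forall i, 0 < w 0 i.

Lemma vertex_word phi s P k Q : word s = P ++ k :: Q ->
  vertex phi s 0 (inord k) = phi (seq_set n (rcons P k)) - phi (seq_set n P).
Proof.
move=> sE; have szP : (size P < n.+1)%N.
  by rewrite -(size_word s) sE size_cat /= addnS ltnS leq_addr.
have sP : s (Ordinal szP) = k :> nat.
  by rewrite -nth_word sE /= nth_cat ltnn subnn.
have -> : inord k = s (Ordinal szP) by rewrite -sP inord_val.
rewrite mxE permK -[X in phi X]/[set s i | i : 'I_n.+1 & (i < (size P).+1)%N].
rewrite !prefix_word sE -{1}cat_rcons.
by rewrite (@take_size_cat _ (size P).+1) ?size_rcons // take_size_cat.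
Qed.

Lemma sum_vertex_word phi s F M B : word s = F ++ M ++ B ->
  \sum_(v <- M) vertex phi s 0 (inord v)
    = phi (seq_set n (F ++ M)) - phi (seq_set n F).
Proof.
elim: M F => [|k M IH] F sE; first by rewrite big_nil cats0 subrr.
rewrite big_cons (vertex_word _ sE) (IH (rcons F k)) ?cat_rcons //.
by rewrite addrC addrA subrK.
Qed.

(** The measure [pi]; [inord] makes it total on sequences of numbers. *)
Definition mass L : R := \sum_(v <- L) (w 0 (inord v))^-1.

Lemma mass_cat L1 L2 : mass (L1 ++ L2) = mass L1 + mass L2.
Proof. exact: big_cat. Qed.

Lemma mass_gt0 v L : 0 < mass (v :: L).
Proof.
rewrite /mass big_cons ltr_pwDl ?invr_gt0 //.
by apply: sumr_ge0 => i _; rewrite invr_ge0 ltW.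
Qed.

(** Along the word [F ++ M1 ++ M2 ++ B], entries [x] satisfy
    [w_j x_j <= w_i x_i], that is [x_j / w_i <= x_i / w_j], for all [i] in [M1] and
    [j] in [M2].  Summing over all these pairs gives the claim, because the
    entries of consecutive elements telescope. *)
Lemma gain_ratio phi F M1 M2 B : payoff_decreasing phi w ->
    perm_eq (F ++ M1 ++ M2 ++ B) (iota 0 n.+1) ->
  mass M1 * (phi (seq_set n (F ++ M1 ++ M2)) - phi (seq_set n (F ++ M1)))
    <= mass M2 * (phi (seq_set n (F ++ M1)) - phi (seq_set n F)).
Proof.
move=> dec /[dup] permL /word_surj [s sE].
rewrite -(sum_vertex_word _ sE) catA -(sum_vertex_word (B := B) phi (s := s)); last first.
  by rewrite sE !catA.
rewrite /mass !big_distrlr /= [X in _ <= X]exchange_big /=.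
rewrite [X in X <= _]big_seq [X in _ <= X]big_seq; apply: ler_sum => i iM.
rewrite [X in X <= _]big_seq [X in _ <= X]big_seq; apply: ler_sum => j jM.
have [ltn_ij lt_i lt_j]: [/\ (index i (word s) < index j (word s))%N,
    (i < n.+1)%N & (j < n.+1)%N].
  have: uniq (F ++ M1 ++ M2 ++ B) by rewrite (perm_uniq permL) iota_uniq.
  have lt v : v \in F ++ M1 ++ M2 ++ B -> (v < n.+1)%N.
    by rewrite (perm_mem permL) mem_iota.
  rewrite !lt ?mem_cat ?iM ?jM ?orbT // => uL; split=> //.
  move: uL; rewrite catA cat_uniq => /and3P[_ /hasPn nFM _].
  have take_s : take (size (F ++ M1)) (word s) = F ++ M1.
    by rewrite sE catA take_size_cat.
  apply: (@leq_trans (size (F ++ M1))); last rewrite leqNgt;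
    rewrite -in_take ?sE ?mem_cat ?iM ?jM ?orbT // -sE take_s.
    by rewrite mem_cat iM orbT.
  by apply: nFM; rewrite mem_cat jM.
have := dec s (inord i) (inord j); rewrite -!index_word /= !inordK // => /(_ ltn_ij).
rewrite /payoff; set x := vertex _ _ _ _; set y := vertex _ _ _ _ => le_xy.
rewrite -(ler_pM2l (w_gt0 (inord i))) -(ler_pM2l (w_gt0 (inord j))).
by rewrite mulVKf ?mulrA ?[_ * w 0 (inord i)]mulrC -?mulrA ?mulVKf ?gt_eqF.
Qed.

(** * The random order *)

(** The solution [p] of [p * first + (1 - p) * last = share], where [share] is
    what [k] receives if [total] is split in proportion to the [1 / w_j].  For
    a monotone payoff [share] lies between [first] and [last]; if these are equal,
    any bias solves the equation, and division by zero yields [p = 0]. *)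
Definition coin phi k F : R :=
  let total := phi (seq_set n (F ++ iota 0 k.+1)) - phi (seq_set n F) in
  let first := phi (seq_set n (rcons F k)) - phi (seq_set n F) in
  let last := phi (seq_set n (F ++ iota 0 k.+1)) - phi (seq_set n (F ++ iota 0 k)) in
  (total / (w 0 (inord k) * mass (iota 0 k.+1)) - last) / (first - last).

(** Conditional distribution of the order, given that [F] and [B] occupy the two
    ends and that the elements below [k] are still to be placed. *)
Fixpoint law phi k F B s : R :=
  if k is k'.+1 then
    coin phi k' F * law phi k' (rcons F k') B s
    + (1 - coin phi k' F) * law phi k' F (k' :: B) s
  else (word s == F ++ B)%:R.

Lemma mass_iotaS k : mass (iota 0 k.+1) = (w 0 (inord k))^-1 + mass (iota 0 k).
Proof. by rewrite iotaSr -cats1 mass_cat addrC /mass big_seq1. Qed.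

Lemma mass_iota_gt0 k : 0 < mass (iota 0 k.+1).
Proof. exact: mass_gt0. Qed.

(** Both halves of [last <= share <= first] are instances of [gain_ratio], with
    [k] placed before and after [0, ..., k - 1]. *)
Lemma coin_spec phi k F B : payoff_decreasing phi w ->
    perm_eq (F ++ iota 0 k.+1 ++ B) (iota 0 n.+1) ->
  let total := phi (seq_set n (F ++ iota 0 k.+1)) - phi (seq_set n F) in
  let first := phi (seq_set n (rcons F k)) - phi (seq_set n F) in
  let last := phi (seq_set n (F ++ iota 0 k.+1)) - phi (seq_set n (F ++ iota 0 k)) in
  let p := coin phi k F in
  0 <= p <= 1 /\
  p * first + (1 - p) * last = total / (w 0 (inord k) * mass (iota 0 k.+1)).
Proof.
move=> dec permL total first last p.
have mk0 := mass_iota_gt0 k.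
have := gain_ratio dec (free_front permL); rewrite seq_set_front cats1.
have := gain_ratio dec (free_back permL); rewrite cats1 -iotaSr.
have -> : mass [:: k] = (w 0 (inord k))^-1 by rewrite /mass big_seq1.
have wk := w_gt0 (inord k).
have m1E := mass_iotaS k.
have -> : mass (iota 0 k) = mass (iota 0 k.+1) - (w 0 (inord k))^-1.
  by rewrite m1E addrC addKr.
rewrite -/last -/first.
have -> : phi (seq_set n (F ++ iota 0 k)) - phi (seq_set n F) = total - last.
  by rewrite /total /last; ring.
have -> : phi (seq_set n (F ++ iota 0 k.+1)) - phi (seq_set n (rcons F k))
    = total - first.
  by rewrite /total /first; ring.
rewrite {}/p /coin -/last -/first -/total.
move: (mass (iota 0 k.+1)) (w 0 (inord k)) mk0 wk {m1E} => m c m0 c0 le_last le_first.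
have cm0 : 0 < c * m by rewrite mulr_gt0.
set r := total / (c * m).
have rE : r * m = total * c^-1 by rewrite /r; field; rewrite ?gt_eqF.
have last_le : last <= r by rewrite -(ler_pM2r m0) rE; lra.
have first_ge : r <= first by rewrite -(ler_pM2r m0) rE; lra.
have [eq_fl|neq_fl] := eqVneq first last.
  by rewrite eq_fl subrr invr0 mulr0; split; [rewrite lexx ler01|lra].
have fl_gt0 : 0 < first - last by rewrite subr_gt0 lt_neqAle eq_sym neq_fl; lra.
split; last by field; rewrite subr_eq0.
by rewrite divr_ge0 ?subr_ge0 ?ler_pdivrMr // ?mul1r; lra.
Qed.

Lemma law_ge0 phi k F B s : payoff_decreasing phi w ->
  perm_eq (F ++ iota 0 k ++ B) (iota 0 n.+1) -> 0 <= law phi k F B s.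
Proof.
move=> dec; elim: k F B => [|k IH] F B permL; first exact: ler0n.
have [/andP[p0 p1] _] := coin_spec dec permL.
have lawF := IH (rcons F k) B; rewrite cat_rcons in lawF.
by apply: addr_ge0; apply: mulr_ge0;
  rewrite ?subr_ge0 //; [apply/lawF/free_front | apply/IH/free_back].
Qed.

Lemma law_sum1 phi k F B : perm_eq (F ++ iota 0 k ++ B) (iota 0 n.+1) ->
  \sum_s law phi k F B s = 1.
Proof.
elim: k F B => [|k IH] F B permL /=.
  have [s sE] := word_surj permL.
  rewrite (bigD1 s) //= sE eqxx big1 ?addr0 // => t; rewrite -sE => neq_ts.
  case: eqP => // wE; case/eqP: neq_ts; apply/permP => i.
  by apply/val_inj; rewrite /= -!nth_word wE.
have lawF := IH (rcons F k) B; rewrite cat_rcons in lawF.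
rewrite big_split -!mulr_sumr /= (lawF (free_front permL)).
by rewrite (IH _ _ (free_back permL)) !mulr1 subrKC.
Qed.

Lemma law_word phi k F B s : law phi k F B s != 0 ->
  exists M, word s = F ++ M ++ B.
Proof.
elim: k F B => [|k IH] F B /=.
  by case: (word s =P F ++ B) => [-> _|_]; [exists [::] | rewrite eqxx].
have [front0 | /IH[M ->] _] := eqVneq (law phi k (rcons F k) B s) 0.
  rewrite front0 mulr0 add0r mulf_eq0 negb_or => /andP[_ /IH[M ->]].
  by exists (rcons M k); rewrite cat_rcons.
by exists (k :: M); rewrite cat_rcons.
Qed.

(** An element already placed has the same entry in every order that can still
    come out, so the rest of the lottery does not change its mean. *)
Lemma law_mean_const phi k F B c (v : 'I_n.+1) :
    perm_eq (F ++ iota 0 k ++ B) (iota 0 n.+1) ->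
    (forall s M, word s = F ++ M ++ B -> vertex phi s 0 v = c) ->
  \sum_s law phi k F B s * vertex phi s 0 v = c.
Proof.
move=> permL vE; rewrite -[RHS]mul1r -(law_sum1 phi permL) mulr_suml.
apply: eq_bigr => s _; have [->|/law_word[M /vE -> //]] := eqVneq (law phi k F B s) 0.
by rewrite !mul0r.
Qed.

(** Let [k] be the element placed next.  For [v = k] the two branches contribute [first] and [last], and the bias is
    chosen for this case.  For [v < k] the induction hypothesis gives, in the two
    branches, the same fraction of [total - first] and of [total - last]; their
    mean is that fraction of [total - share]. *)
Lemma law_mean phi k F B v : payoff_decreasing phi w ->
    perm_eq (F ++ iota 0 k ++ B) (iota 0 n.+1) -> (v < k)%N ->
  \sum_s law phi k F B s * vertex phi s 0 (inord v)
  = (phi (seq_set n (F ++ iota 0 k)) - phi (seq_set n F))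
    / (w 0 (inord v) * mass (iota 0 k)).
Proof.
move=> dec; elim: k F B => // k IH F B permL.
have pf : perm_eq (rcons F k ++ iota 0 k ++ B) (iota 0 n.+1).
  by rewrite cat_rcons free_front.
have pb := free_back permL.
rewrite /=; have [_] := coin_spec dec permL.
set total := phi (seq_set n (F ++ iota 0 k.+1)) - phi (seq_set n F).
move: (coin phi k F) => p pE.
under eq_bigr do rewrite mulrDl -(mulrA p) -(mulrA (1 - p)).
rewrite big_split -!mulr_sumr /= ltnS leq_eqVlt => /orP[/eqP-> | lt_vk].
  rewrite (law_mean_const pf
    (c := phi (seq_set n (rcons F k)) - phi (seq_set n F))); last first.
    by move=> s M; rewrite cat_rcons => /vertex_word.
  rewrite (law_mean_const pb (c := phi (seq_set n (F ++ iota 0 k.+1))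
                                   - phi (seq_set n (F ++ iota 0 k)))) //.
  (* The middle part [M] is unknown, but as a set it is what [F], [k] and [B]
     leave over. *)
  move=> s M sE; have memM: F ++ M =i F ++ iota 0 k.
    apply: perm_mem; rewrite -(perm_cat2r (k :: B)) -!catA -sE.
    by rewrite (permPl (perm_word s)) perm_sym.
  rewrite (@vertex_word _ _ (F ++ M) k B); last by rewrite sE catA.
  rewrite (eq_seq_set _ memM); congr (phi _ - _); apply: eq_seq_set => x.
  by rewrite iotaSr -!cats1 catA mem_cat memM [RHS]mem_cat.
rewrite (IH _ _ pf lt_vk) (IH _ _ pb lt_vk) /=.
rewrite -[rcons F k]cats1 -catA seq_set_front cats1.
have mk0 := mass_iota_gt0 k.
have m0 : 0 < mass (iota 0 k) by case: (k) lt_vk => // k' _; exact: mass_iota_gt0.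
have wk := w_gt0 (inord k); have wv := w_gt0 (inord v).
move: pE; set first := phi (seq_set n (rcons F k)) - _.
set last := phi _ - phi (seq_set n (F ++ iota 0 k)).
have -> : phi (seq_set n (F ++ iota 0 k)) - phi (seq_set n F) = total - last.
  by rewrite /total /last; ring.
have -> : phi (seq_set n (F ++ iota 0 k.+1)) - phi (seq_set n (rcons F k))
    = total - first.
  by rewrite /total /first; ring.
move: mk0; rewrite mass_iotaS.
move: (mass (iota 0 k)) (w 0 (inord k)) (w 0 (inord v)) m0 wk wv total first last.
move=> m c cv m0 c0 cv0 total first last mk0 pE.
(* The expected entry of [k] appears, and [pE] evaluates it. *)
transitivity ((total - (p * first + (1 - p) * last)) / (cv * m)); first by ring.
have cm0 : 0 < 1 + m * c by have := mulr_gt0 m0 c0; lra.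
by rewrite pE; field; rewrite !gt_eqF.
Qed.

(** * The equalizing point *)

Definition equalizer phi : 'rV[R]_n.+1 :=
  \row_j (phi setT / (w 0 j * mass (iota 0 n.+1))).

Definition strategy phi : {ffun 'S_n.+1 -> R} :=
  [ffun s => law phi n.+1 [::] [::] s].

Lemma seq_set_nil : seq_set n [::] = set0.
Proof. by apply/setP => v; rewrite !inE. Qed.

Lemma seq_set_iota : seq_set n (iota 0 n.+1) = setT.
Proof. by apply/setP => v; rewrite in_setT inE mem_iota ltn_ord. Qed.

Lemma perm_iota_cats0 : perm_eq ([::] ++ iota 0 n.+1 ++ [::]) (iota 0 n.+1).
Proof. by rewrite cats0. Qed.

Lemma mixed_strategy_strategy phi : payoff_decreasing phi w ->
  mixed_strategy (strategy phi).
Proof.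
move=> dec; split=> [s|]; first by rewrite ffunE (law_ge0 _ dec) // perm_iota_cats0.
under eq_bigr do rewrite ffunE.
by rewrite law_sum1 // perm_iota_cats0.
Qed.

Lemma mixed_point_strategy phi : payoff_decreasing phi w -> phi set0 = 0 ->
  mixed_point phi (strategy phi) = equalizer phi.
Proof.
move=> dec phi0; apply/rowP => j; rewrite summxE mxE.
rewrite -{1}[j]inord_val; under eq_bigr do rewrite mxE ffunE.
rewrite (law_mean dec perm_iota_cats0) ?ltn_ord //.
by rewrite seq_set_nil phi0 seq_set_iota subr0 inord_val.
Qed.

Lemma mass_set (S : {set 'I_n.+1}) :
  mass [seq val v | v <- enum S] = \sum_(j in S) (w 0 j)^-1.
Proof.
rewrite /mass big_map -big_enum /=.
by apply: eq_bigr => j _; rewrite inord_val.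
Qed.

Lemma seq_set_enum (S : {set 'I_n.+1}) : seq_set n [seq val v | v <- enum S] = S.
Proof. by apply/setP => v; rewrite inE mem_map ?mem_enum //; exact: val_inj. Qed.

Lemma mass_setT : mass (iota 0 n.+1) = \sum_j (w 0 j)^-1.
Proof.
rewrite -val_enum_ord /mass big_map big_enum /=.
by apply: eq_bigr => j _; rewrite inord_val.
Qed.

Lemma sum_equalizer phi (S : {set 'I_n.+1}) :
  \sum_(j in S) equalizer phi 0 j
  = phi setT * mass [seq val v | v <- enum S] / mass (iota 0 n.+1).
Proof.
rewrite mass_set mulr_sumr mulr_suml; apply: eq_bigr => j _.
by rewrite mxE invfM mulrA.
Qed.

Lemma sum_equalizerT phi : \sum_j equalizer phi 0 j = phi setT.
Proof.
under eq_bigr do rewrite mxE invfM mulrA.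
rewrite -mulr_suml -mulr_sumr -mass_setT mulfK //.
by rewrite gt_eqF ?mass_iota_gt0.
Qed.

(** [gain_ratio] for an order that lists [S] first and its complement next. *)
Lemma equalizer_le phi (S : {set 'I_n.+1}) : payoff_decreasing phi w ->
  phi set0 = 0 -> \sum_(j in S) equalizer phi 0 j <= phi S.
Proof.
move=> dec phi0; rewrite sum_equalizer.
set M1 := map _ _; pose M2 := [seq val v | v <- enum (~: S)].
have permM : perm_eq ([::] ++ M1 ++ M2 ++ [::]) (iota 0 n.+1).
  rewrite cats0 /= -map_cat -val_enum_ord perm_map //.
  apply: uniq_perm; rewrite ?enum_uniq // ?cat_uniq ?enum_uniq /= ?andbT.
    by apply/hasPn => v; rewrite !mem_enum inE.
  by move=> v; rewrite mem_cat !mem_enum inE orbN.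
have := gain_ratio dec permM; rewrite /= seq_set_nil phi0 subr0 seq_set_enum.
have -> : seq_set n (M1 ++ M2) = setT.
  rewrite -seq_set_iota; apply: eq_seq_set.
  by rewrite -(cats0 (M1 ++ M2)) -catA; apply: perm_mem.
have := mass_iota_gt0 n; have -> : mass (iota 0 n.+1) = mass M1 + mass M2.
  by rewrite -mass_cat -[M1 ++ M2]cats0 -catA; apply: perm_big; rewrite perm_sym.
by move=> m0; rewrite ler_pdivrMr //; lra.
Qed.

Lemma coin_opp phi k F : coin (fun S => - phi S) k F = coin phi k F.
Proof.
have quotNN x y : - x / - y = x / y :> R by rewrite invrN mulrNN.
by rewrite /coin -[RHS]quotNN; congr (_ * _^-1); ring.
Qed.

Lemma law_opp phi k F B s :
  law (fun S => - phi S) k F B s = law phi k F B s.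
Proof. by elim: k F B => //= k IH F B; rewrite !IH coin_opp. Qed.

End Decreasing.

(** * The program *)

(** Register allocation.  Index registers: 0 holds the number of elements, 1 the
    number [k] of elements to place, 2 the constant 1, 3 the number of filled
    front positions, 4 an address, and 5, which is never written, the constant 0.
    Real registers: 0 holds [pi({0, ..., k - 1})], 1 the constant 1, 9 the coin.
    Set register 0 holds the front elements, set register 1 the front elements
    together with those still to be placed. *)
Section Program.

Definition fill_body : seq op :=
  [:: SInsert 1 1; RLoad 2 1; RDiv 2 1 2; RAdd 0 0 2; IAdd 1 1 2].

(** Set registers are updated between the queries, so that the four values needed
    by [coin] cost one element change each.  Afterwards set register 0 also
    contains [k] and set register 1 no longer does: the right contents of the
    first if [k] goes to the front, and of the second if [k] goes to the back. *)
Definition toss_body : seq op :=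
  [:: ISub 1 1 2; Query 3 1; Query 4 0; SInsert 0 1; Query 5 0; SDelete 1 1;
      Query 6 1; RLoad 2 1; RSub 7 3 4; RSub 8 5 4; RSub 6 3 6;
      RMul 9 2 0; RDiv 9 7 9; RSub 9 9 6; RSub 8 8 6; RDiv 9 9 8;
      RDiv 2 1 2; RSub 0 0 2].

Definition front_body : seq op := [:: IStore 3 1; IAdd 3 3 2; SInsert 1 1].

Definition back_body : seq op := [:: IAdd 4 3 1; IStore 4 1; SDelete 0 1].

Definition fill_loop : instr := While (ILt 1 0) (map Do fill_body).

Definition place_loop : instr :=
  While (ILt 5 1)
    (map Do toss_body ++ [:: Flip 9 (map Do front_body) (map Do back_body)]).

Definition generator : program :=
  [:: Do (IConst 2 1); Do (RConst 1 1); fill_loop; place_loop].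

Variables (R : realType) (n : nat) (w : 'rV[R]_n.+1) (phi : {set 'I_n.+1} -> R).
Implicit Types (s : 'S_n.+1) (F B : seq nat) (st : state R).

Definition run (ops : seq op) st : state R :=
  foldl (fun st o => exec phi o st) st ops.

Lemma output_prob_run ops t K st s :
  output_prob phi (size ops + t) (map Do ops ++ K) st s
  = output_prob phi t K (run ops st) s.
Proof. by elim: ops st => //= o ops IH st; rewrite IH. Qed.

Lemma output_prob_enter t b K1 K st s : eval_test b st ->
  output_prob phi t.+1 (While b K1 :: K) st s
  = output_prob phi t (K1 ++ While b K1 :: K) st s.
Proof. by move=> /= ->. Qed.

Lemma output_prob_exit t b K1 K st s : ~~ eval_test b st ->
  output_prob phi t.+1 (While b K1 :: K) st s = output_prob phi t K st s.
Proof. by move=> /= /negbTE->. Qed.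

Lemma output_prob_flip t a K1 K2 K st s : 0 <= rreg st a <= 1 ->
  output_prob phi t.+1 (Flip a K1 K2 :: K) st s
  = rreg st a * output_prob phi t (K1 ++ K) st s
    + (1 - rreg st a) * output_prob phi t (K2 ++ K) st s.
Proof. by move=> /= ->. Qed.

(** Invariant of both loops, with [F] and [B] the contents of the two ends of the
    output array.  In the first loop they are empty. *)
Record encodes k F B st : Prop := Encodes {
  enc_k : ireg st 1 = k;
  enc_one : ireg st 2 = 1%N;
  enc_size : ireg st 3 = size F;
  enc_zero : ireg st 5 = 0%N;
  enc_mass : rreg st 0 = mass w (iota 0 k);
  enc_unit : rreg st 1 = 1;
  enc_w : forall j : 'I_n.+1, rarr st j = w 0 j;
  enc_F : forall v, sreg st 0 v = (v \in F);
  enc_FI : forall v, sreg st 1 v = (v \in F ++ iota 0 k);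
  enc_front : forall i, (i < size F)%N -> iarr st i = nth 0%N F i;
  enc_back : forall i, (i < size B)%N -> iarr st (size F + k + i)%N = nth 0%N B i }.


(** The state just before the coin decides on [k]; the position of [B] is still
    counted with [k] among the free elements. *)
Record tossed k F B st : Prop := Tossed {
  toss_k : ireg st 1 = k;
  toss_one : ireg st 2 = 1%N;
  toss_size : ireg st 3 = size F;
  toss_zero : ireg st 5 = 0%N;
  toss_mass : rreg st 0 = mass w (iota 0 k);
  toss_unit : rreg st 1 = 1;
  toss_coin : rreg st 9 = coin w phi k F;
  toss_w : forall j : 'I_n.+1, rarr st j = w 0 j;
  toss_Fk : forall v, sreg st 0 v = (v \in rcons F k);
  toss_FI : forall v, sreg st 1 v = (v \in F ++ iota 0 k);
  toss_front : forall i, (i < size F)%N -> iarr st i = nth 0%N F i;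
  toss_back : forall i, (i < size B)%N ->
    iarr st (size F + k.+1 + i)%N = nth 0%N B i }.

Lemma query_set (b : nat -> bool) (L : seq nat) :
  (forall v, b v = (v \in L)) -> [set v : 'I_n.+1 | b v] = seq_set n L.
Proof. by move=> bE; apply/setP => v; rewrite !inE bE. Qed.

(** The registers after the straight-line code are stated as closed expressions
    in the old ones and checked by conversion; only then is the invariant used
    to interpret them. *)
Lemma run_toss k F B st : encodes k.+1 F B st -> (k < n.+1)%N -> k \notin F ->
  tossed k F B (run toss_body st).
Proof.
move=> enc k_lt nFk.
have iE : (ireg st 1 - ireg st 2)%N = k by rewrite enc.(enc_k) enc.(enc_one) subn1.
have iregE : ireg (run toss_body st) = upd (ireg st) 1 k by rewrite -iE; case: (st).
have iarrE : iarr (run toss_body st) = iarr st by case: (st).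
have rarrE : rarr (run toss_body st) = rarr st by case: (st).
have S0 v : upd (sreg st 0) k true v = (v \in rcons F k).
  by rewrite /upd mem_rcons inE enc.(enc_F); case: eqP.
have S1 v : upd (sreg st 1) k false v = (v \in F ++ iota 0 k).
  rewrite /upd enc.(enc_FI) iotaSr -cats1 catA !mem_cat mem_seq1.
  by case: eqP => [->|]; rewrite ?orbF // mem_iota (negbTE nFk) ltnn.
have wk : rarr st k = w 0 (inord k).
  by rewrite -[k in LHS]/(val (Ordinal k_lt)) enc.(enc_w) -[Ordinal _]inord_val.
split=> //.
- by rewrite iregE.
- by rewrite iregE /upd /= enc.(enc_one).
- by rewrite iregE /upd /= enc.(enc_size).
- by rewrite iregE /upd /= enc.(enc_zero).
- have -> : rreg (run toss_body st) 0 = rreg st 0 - rreg st 1 / rarr st k.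
    by rewrite -iE; case: (st).
  by rewrite wk enc.(enc_mass) enc.(enc_unit) mass_iotaS div1r [X in X - _]addrC addrK.
- by rewrite -enc.(enc_unit); case: (st).
- transitivity
   (let total := phi [set v : 'I_n.+1 | sreg st 1 v]
                 - phi [set v : 'I_n.+1 | sreg st 0 v] in
    let first := phi [set v : 'I_n.+1 | upd (sreg st 0) k true v]
                 - phi [set v : 'I_n.+1 | sreg st 0 v] in
    let last := phi [set v : 'I_n.+1 | sreg st 1 v]
                - phi [set v : 'I_n.+1 | upd (sreg st 1) k false v] in
    (total / (rarr st k * rreg st 0) - last) / (first - last)).
    by rewrite -iE; case: (st).
  rewrite (query_set enc.(enc_F)) (query_set enc.(enc_FI)) (query_set S0) (query_set S1).
  by rewrite wk enc.(enc_mass).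
- by rewrite rarrE; exact: enc.(enc_w).
- by move=> v; rewrite -S0 -iE; case: (st).
- by move=> v; rewrite -S1 -iE; case: (st).
- by rewrite iarrE; exact: enc.(enc_front).
- by rewrite iarrE; exact: enc.(enc_back).
Qed.

Lemma run_front k F B st : tossed k F B st ->
  encodes k (rcons F k) B (run front_body st).
Proof.
case: st => ir ia rr ra sr [/= ik i1 iF i0 rm r1 _ raE sFk sFI front back].
split; rewrite //= /upd //=.
- by rewrite i1 iF size_rcons addn1.
- move=> v; rewrite ik sFI cat_rcons !mem_cat inE.
  by case: eqP; rewrite ?orbT.
- move=> i; rewrite size_rcons ltnS nth_rcons iF ik leq_eqVlt.
  by case: eqP => [->|_] /=; [rewrite ltnn | move=> i_lt; rewrite i_lt front].
- move=> i i_lt; rewrite iF size_rcons.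
  by rewrite gtn_eqF -?back ?addnS ?addSn //; lia.
Qed.

Lemma run_back k F B st : k \notin F -> tossed k F B st ->
  encodes k F (k :: B) (run back_body st).
Proof.
move=> nFk; case: st => ir ia rr ra sr [/= ik i1 iF i0 rm r1 _ raE sFk sFI front back].
split; rewrite //= /upd //=.
- move=> v; rewrite ik sFk mem_rcons inE.
  by case: eqP => [->|]; rewrite ?(negbTE nFk).
- by move=> i i_lt; rewrite iF ik ltn_eqF ?front //; lia.
- move=> [_|i]; rewrite iF ik; first by rewrite addn0 eqxx.
  rewrite ltnS /= => i_lt; rewrite gtn_eqF; last by lia.
  by rewrite -back //; congr (ia _); lia.
Qed.

Lemma outputs_encoded F B st s :
    perm_eq (F ++ B) (iota 0 n.+1) -> encodes 0 F B st ->
  outputs st s = (word s == F ++ B).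
Proof.
move=> permL enc; have szL := perm_size permL; rewrite size_iota in szL.
have iarrE i : (i < n.+1)%N -> iarr st i = nth 0%N (F ++ B) i.
  rewrite -szL size_cat nth_cat => i_lt; case: ltnP => [/enc.(enc_front) //|le_Fi].
  rewrite -enc.(enc_back) ?addn0 ?subnKC //.
  by rewrite ltn_subLR.
apply/forallP/eqP => [out|sE i]; last by rewrite -nth_word sE iarrE.
apply: (@eq_from_nth _ 0%N) => [|i]; rewrite size_word // => i_lt.
by rewrite -iarrE // -[i]/(val (Ordinal i_lt)) nth_word (eqP (out _)).
Qed.

(** A round takes 23 steps: the loop test, 18 operations, the flip, and 3
    operations in either branch.  That all coins are in the unit interval is a
    hypothesis because the reason differs for the two kinds of payoff. *)
Lemma place_correct k F B st t s :
    (forall k F B, perm_eq (F ++ iota 0 k.+1 ++ B) (iota 0 n.+1) ->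
      0 <= coin w phi k F <= 1) ->
    perm_eq (F ++ iota 0 k ++ B) (iota 0 n.+1) -> encodes k F B st ->
  output_prob phi (23 * k + 1 + t) [:: place_loop] st s = law w phi k F B s.
Proof.
move=> coin01; elim: k F B st => [|k IH] F B st permL enc.
  rewrite muln0 add0n add1n /= enc.(enc_k) enc.(enc_zero) /=.
  by rewrite -(outputs_encoded s permL enc); case: (t).
have -> : (23 * k.+1 + 1 + t
    = (size toss_body + (size front_body + (23 * k + 1 + t)).+1).+1)%N.
  by rewrite /=; lia.
have nFk : k \notin F.
  have : uniq (F ++ iota 0 k.+1 ++ B) by rewrite (perm_uniq permL) iota_uniq.
  rewrite cat_uniq => /and3P[_ /hasPn nF _]; apply: nF.
  by rewrite mem_cat mem_iota /= ltnSn.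
have k_lt : (k < n.+1)%N.
  suff : k \in iota 0 n.+1 by rewrite mem_iota.
  by rewrite -(perm_mem permL) !mem_cat mem_iota ltnSn orbT.
have toss := run_toss enc k_lt nFk.
rewrite output_prob_enter; last by rewrite /= enc.(enc_k) enc.(enc_zero).
rewrite -catA output_prob_run.
rewrite output_prob_flip toss.(toss_coin) ?(coin01 k F B) //.
rewrite (output_prob_run front_body) (output_prob_run back_body).
rewrite (IH _ _ _ _ (run_front toss)); last first.
  by rewrite cat_rcons; exact: free_front permL.
by rewrite (IH _ _ _ (free_back permL) (run_back nFk toss)).
Qed.

Lemma run_fill k st : encodes k [::] [::] st -> (k < n.+1)%N ->
  encodes k.+1 [::] [::] (run fill_body st) /\ ireg (run fill_body st) 0 = ireg st 0.
Proof.
case: st => ir ia rr ra sr [/= ik i1 iF i0 rm r1 raE sF sI _ _] k_lt.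
have kE : k = val (Ordinal k_lt) by [].
split=> //; split; rewrite //= /upd /= ?ik.
- by rewrite i1 addn1.
- rewrite rm r1 kE raE div1r iotaSr -cats1 mass_cat.
  by rewrite -[X in w 0 X]inord_val /mass big_seq1.
- move=> v; rewrite sI iotaSr -cats1 mem_cat mem_seq1.
  by case: eqP => [->|]; rewrite ?orbT ?orbF.
Qed.

(** Summing the [1 / w_j] takes 6 steps per element. *)
Lemma fill_correct m k st : encodes k [::] [::] st -> ireg st 0 = n.+1 ->
    (k + m)%N = n.+1 ->
  exists2 st', encodes n.+1 [::] [::] st' &
    forall t K s, output_prob phi (6 * m + 1 + t) (fill_loop :: K) st s
                  = output_prob phi t K st' s.
Proof.
elim: m k st => [|m IH] k st enc stn kmE.
  exists st; first by rewrite -kmE addn0.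
  move=> t K s; rewrite muln0 add0n add1n output_prob_exit //.
  by rewrite /= stn enc.(enc_k) -kmE addn0 ltnn.
have k_lt : (k < n.+1)%N by lia.
have [enc' stn'] := run_fill enc k_lt.
have [||st' enc'' outE] := IH k.+1 _ enc'.
- by rewrite stn'.
- by rewrite addSnnS.
exists st' => // t K s; rewrite -outE -(output_prob_run fill_body).
have -> : (6 * m.+1 + 1 + t = (size fill_body + (6 * m + 1 + t)).+1)%N.
  by rewrite /=; lia.
by rewrite output_prob_enter // /= stn enc.(enc_k).
Qed.

Lemma generator_correct s :
    (forall k F B, perm_eq (F ++ iota 0 k.+1 ++ B) (iota 0 n.+1) ->
      0 <= coin w phi k F <= 1) ->
  output_prob phi (33 * n.+1) generator (init_state w) s = law w phi n.+1 [::] [::] s.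
Proof.
move=> coin01.
pose st := run [:: IConst 2 1; RConst 1 1] (init_state w).
have enc : encodes 0 [::] [::] st.
  split; rewrite //= ?/mass ?big_nil // => j.
  by rewrite valK.
have [||st' enc' outE] := @fill_correct n.+1 0 st enc => //.
(* The last summand is slack: a halted program ignores the remaining time. *)
have -> : (33 * n.+1 = 2 + (6 * n.+1 + 1 + (23 * n.+1 + 1 + 4 * n)))%N by lia.
rewrite (output_prob_run [:: IConst 2 1; RConst 1 1]) outE.
exact: place_correct coin01 (perm_iota_cats0 n) enc'.
Qed.

End Program.

(** * Optimality *)

Lemma strategy_opp (R : realType) n (w : 'rV[R]_n.+1) phi :
  strategy w (fun S => - phi S) = strategy w phi.
Proof. by apply/ffunP => s; rewrite !ffunE law_opp. Qed.

Lemma vertex_opp (R : realType) n (phi : {set 'I_n} -> R) s :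
  vertex (fun S => - phi S) s = - vertex phi s.
Proof. by apply/rowP => v; rewrite !mxE -opprD. Qed.

Lemma mixed_point_opp (R : realType) n (phi : {set 'I_n} -> R) theta :
  mixed_point (fun S => - phi S) theta = - mixed_point phi theta.
Proof.
by rewrite /mixed_point -sumrN; apply: eq_bigr => s _; rewrite vertex_opp scalerN.
Qed.

Lemma payoff_increasing_opp (R : realType) n (w : 'rV[R]_n) phi :
  payoff_increasing phi w -> payoff_decreasing (fun S => - phi S) w.
Proof.
by move=> inc s i j /inc; rewrite /payoff vertex_opp !mxE !mulrN lerN2.
Qed.

Lemma equalizer_opp (R : realType) n (w : 'rV[R]_n.+1) phi :
  equalizer w (fun S => - phi S) = - equalizer w phi.
Proof. by apply/rowP => j; rewrite !mxE mulNr. Qed.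

(** The minimum is at most each [w_j y_j]; dividing by [w_j] and summing leaves
    only the total of [y], which all points of a base polyhedron share. *)
Lemma min_payoff_le (R : realType) n (w y : 'rV[R]_n.+1) :
  (forall i, 0 < w 0 i) -> min_payoff w y * mass w (iota 0 n.+1) <= \sum_j y 0 j.
Proof.
move=> w_gt0; rewrite mass_setT mulr_sumr; apply: ler_sum => j _.
by rewrite ler_pdivrMr // mulrC; exact: bigmin_le.
Qed.

Lemma max_payoff_ge (R : realType) n (w y : 'rV[R]_n.+1) :
  (forall i, 0 < w 0 i) -> \sum_j y 0 j <= max_payoff w y * mass w (iota 0 n.+1).
Proof.
move=> w_gt0; rewrite mass_setT mulr_sumr; apply: ler_sum => j _.
by rewrite ler_pdivlMr // mulrC; exact: le_bigmax.
Qed.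

Lemma equalizer_payoff (R : realType) n (w : 'rV[R]_n.+1) phi j :
  (forall i, 0 < w 0 i) ->
  w 0 j * equalizer w phi 0 j = phi setT / mass w (iota 0 n.+1).
Proof.
by move=> w_gt0; rewrite mxE invfM mulrCA (mulrA (w 0 j)) mulfV ?mul1r // gt_eqF.
Qed.

Lemma generator_generates (R : realType) n (w : 'rV[R]_n.+1) phi :
    (forall i, 0 < w 0 i) ->
    payoff_decreasing phi w \/ payoff_increasing phi w ->
  generates_within generator (33 * n.+1) phi w (strategy w phi).
Proof.
move=> w_gt0 mono s; rewrite ffunE; apply: generator_correct => k F B permL.
case: mono => [dec | /payoff_increasing_opp dec].
  by have [] := coin_spec w_gt0 dec permL.
by rewrite -coin_opp; have [] := coin_spec w_gt0 dec permL.
Qed.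

Theorem theorem10 (R : realType) :
  (exists (P : program) (C : nat),
     forall (n : nat) (w : 'rV[R]_n.+1) (f : {set 'I_n.+1} -> R),
       (forall i, 0 < w 0 i) ->
       (forall S, 0 <= f S) ->
       nondecreasing_fun f ->
       submodular f ->
       f set0 = 0 ->
       payoff_decreasing f w ->
       exists theta : {ffun 'S_n.+1 -> R},
         optimal_max f w theta /\
         generates_within P (C * n.+1) f w theta)
  /\
  (exists (P : program) (C : nat),
     forall (n : nat) (w : 'rV[R]_n.+1) (g : {set 'I_n.+1} -> R),
       (forall i, 0 < w 0 i) ->
       (forall S, 0 <= g S) ->
       nondecreasing_fun g ->
       supermodular g ->
       g set0 = 0 ->
       payoff_increasing g w ->
       exists theta : {ffun 'S_n.+1 -> R},
         optimal_min g w theta /\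
         generates_within P (C * n.+1) g w theta).
Proof.
split; exists generator, 33%N => n w phi w_gt0 phi_ge0 _ _ phi0 mono;
  exists (strategy w phi);
  (split; last by apply: generator_generates; [|by [left|right]]);
  have m0 : 0 < mass w (iota 0 n.+1) by exact: mass_iota_gt0.
  split; first exact: mixed_strategy_strategy.
    rewrite mixed_point_strategy //; split.
    - by move=> j; rewrite mxE divr_ge0 // ltW // mulr_gt0.
    - by move=> S; exact: equalizer_le.
    - exact: sum_equalizerT.
  move=> y [_ _ sum_y]; rewrite mixed_point_strategy //.
  have le_c : min_payoff w y <= phi setT / mass w (iota 0 n.+1).
    by rewrite ler_pdivlMr // -sum_y; exact: min_payoff_le.
  by apply: le_bigmin => [|j _]; rewrite equalizer_payoff.
have dec := payoff_increasing_opp mono.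
have opp0 : - phi set0 = 0 by rewrite phi0 oppr0.
have pointE : mixed_point phi (strategy w phi) = equalizer w phi.
  apply: oppr_inj; rewrite -mixed_point_opp -strategy_opp -equalizer_opp.
  exact: mixed_point_strategy.
split; first by rewrite -strategy_opp; exact: mixed_strategy_strategy.
  rewrite pointE; split; last exact: sum_equalizerT.
  move=> S; have := equalizer_le w_gt0 S dec opp0.
  rewrite equalizer_opp -lerN2 opprK -sumrN.
  by under eq_bigr do rewrite mxE opprK.
move=> y [_ sum_y]; rewrite pointE.
have ge_c : phi setT / mass w (iota 0 n.+1) <= max_payoff w y.
  by rewrite ler_pdivrMr // -sum_y; exact: max_payoff_ge.
by apply: bigmax_le => [|j _]; rewrite equalizer_payoff.
Qed.
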